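(* Let $(X_p)_{p\in\mathcal P}$ be independent symmetric non-constant real random variables with $M:=\sup_{p\in\mathcal P}\|X_p\|_{L^\infty}<\infty$, and let $S_n=\sum_{\ell=1}^n\theta_\ell$ be the partial sums of the associated random multiplicative function of Rademacher type. Let $M_n=\max(M,1)^{\frac{c\ln n}{\ln\ln n}}$, where $c$ is any constant such that $\omega(\ell)\le \frac{c\ln \ell}{\ln\ln \ell}$ for all $\ell$ large enough. Then for every $k\in\mathbb N$ there exists a constant $C_k$ such that for all integers $n\ge 2$, $$\mathbb E[(S_n)^{2k}]\le C_k\, n^k (M_n)^{2k}(\ln n)^{2k^2}.$$
   Context: $\mathcal P$ is the set of prime numbers; $\mathbb N=\{1,2,\dots\}$; $\omega(\ell)$ is the number of distinct prime factors of $\ell$. The random variables $X_p$ need not be identically distributed. The random multiplicative function of Rademacher type generated by $(X_p)$ is $\theta_\ell=\prod_{p\mid \ell}X_p$ if $\ell$ is square free (so $\theta_1=1$, empty product), and $\theta_\ell=0$ otherwise. *)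

(* Defs.v *)
From HB Require Import structures.
From mathcomp Require Export all_boot all_order all_algebra.
From mathcomp Require Export all_classical all_reals all_analysis.

Set Implicit Arguments.
Unset Strict Implicit.
Unset Printing Implicit Defensive.

Import Order.TTheory GRing.Theory Num.Theory.
Import numFieldNormedType.Exports.

Local Open Scope classical_set_scope.
Local Open Scope ring_scope.

Definition squarefree (l : nat) : bool :=
  (0 < l)%N && all (fun p => ~~ (p ^ 2 %| l)%N) (primes l).

Definition omega (l : nat) : nat := size (primes l).

Section RandomMultiplicative.
Context (d : measure_display) (T : measurableType d) (R : realType).
Variable P : probability T R.

(* The family is indexed by nat, but only its members of index in D matter. *)
Definition independent_RVs (D : pred nat) (X : nat -> {RV P >-> R}) : Prop :=
  forall (s : seq nat) (A : nat -> set R),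
    uniq s -> all D s -> (forall i, measurable (A i)) ->
    P (\bigcap_(i in [set` s]) (X i @^-1` A i)) =
      (\prod_(i <- s) P (X i @^-1` A i))%E.

Definition symmetric_RV (X : {RV P >-> R}) : Prop :=
  forall A : set R, measurable A ->
    P (X @^-1` A) = P ((fun w => - X w) @^-1` A).

Definition nonconstant_RV (X : {RV P >-> R}) : Prop :=
  ~ exists a : R, {ae P, forall w, X w = a}.

Definition supLoo (X : nat -> {RV P >-> R}) : \bar R :=
  ereal_sup [set Lnorm P +oo%E (EFin \o X p) | p in [set p | prime p]].

Definition theta (X : nat -> {RV P >-> R}) (l : nat) (w : T) : R :=
  if squarefree l then \prod_(p <- primes l) X p w else 0.

Definition partial_sum (X : nat -> {RV P >-> R}) (n : nat) (w : T) : R :=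
  \sum_(1 <= l < n.+1) theta X l w.

End RandomMultiplicative.

(* For n = 2 the exponent is negative, as ln (ln 2) < 0. *)
Definition M_seq (R : realType) (M c : R) (n : nat) : R :=
  Num.max M 1 `^ (c * ln n%:R / ln (ln n%:R)).

(* Main.v *)
(* Expanding S_n^(2k) gives a sum over tuples (l_1, ..., l_2k) of squarefree
   numbers at most n.  By independence and symmetry the expectation of
   theta_(l_1) ... theta_(l_2k) vanishes unless every prime divides an even number
   of the l_i, and it is at most (K M_n)^(2k) otherwise, for a constant K.

   The number of even tuples is bounded without any input on the distribution of
   primes.  For each prime p, pair up the indices i with p | l_i: this yields a
   number a_e for each edge e of the complete graph on the 2k indices, such that
   l_i is the product of the a_e over the edges e at i.  Then
   (prod_e a_e)^2 = prod_i l_i <= n^(2k), so the number of even tuples is at most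
   the sum of n^k / prod_e a_e over all a_e <= n, that is n^k H_n^(k(2k-1)) with
   H_n the harmonic sum, and H_n <= 1 + ln n. *)
Require Import Defs.
From mathcomp Require Import all_boot all_order all_algebra.
From mathcomp Require Import all_classical all_reals all_analysis.
From mathcomp Require Import measurable_realfun ess_sup_inf ring lra.
Set Implicit Arguments.
Unset Strict Implicit.
Unset Printing Implicit Defensive.
Import Order.TTheory GRing.Theory Num.Theory.
Import numFieldNormedType.Exports.
Local Open Scope ring_scope.

(** * Squarefree numbers and their divisors *)

Lemma squarefreeP (l : nat) :
  reflect ((0 < l)%N /\ forall p, prime p -> ~~ (p ^ 2 %| l)%N) (squarefree l).
Proof.
apply: (iffP andP) => -[l0 H]; split => //.
  move=> p pp; case: (boolP (p \in primes l)) => [/(allP H)//|].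
  apply: contra => pl; rewrite mem_primes pp l0 /=.
  by apply: dvdn_trans pl; rewrite expnS dvdn_mulr.
by apply/allP => p; rewrite mem_primes => /andP[pp _]; exact: H.
Qed.

Lemma squarefree_dvd (d l : nat) : (d %| l)%N -> squarefree l -> squarefree d.
Proof.
move=> dl /squarefreeP[l0 H]; apply/squarefreeP; split; first exact: dvdn_gt0 dl.
by move=> p pp; apply: contra (H p pp) => /dvdn_trans; apply.
Qed.

Lemma squarefree_divp (p l : nat) :
  prime p -> (p %| l)%N -> squarefree l -> ~~ (p %| l %/ p)%N.
Proof.
move=> pp /divnK pl /squarefreeP[_ /(_ p pp)]; apply: contra => H.
by rewrite -pl expnS expn1 dvdn_pmul2r ?prime_gt0.
Qed.

(** * Even tuples, their factorisation along the edges of a complete graph, and their number *)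

Section Pairing.
Variable m : nat.

Definition edge := {e : 'I_m * 'I_m | (e.1 < e.2)%N}.

Definition incident (i : 'I_m) (e : edge) : bool :=
  (i == (val e).1) || (i == (val e).2).

(** An edge and its reversal are two different ordered pairs of indices. For [m = 2k] this bounds
    the number of edges by [2k^2], the exponent of the logarithm in the theorem. *)
Lemma card_edge : (2 * #|{: edge}| <= m ^ 2)%N.
Proof.
have -> : (m ^ 2 = #|{: 'I_m * 'I_m}|)%N by rewrite card_prod card_ord expnS expn1.
pose f (x : edge + edge) := match x with
  | inl e => val e | inr e => ((val e).2, (val e).1) end.
have : injective f.
  move=> [[[a b] /= ab]|[[a b] /= ab]] [[[c d] /= cd]|[[c d] /= cd]] //= [ac bd].
  - by congr inl; apply/val_inj => /=; rewrite ac bd.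
  - by move: ab cd; rewrite ac bd => h1 h2; have := ltn_trans h1 h2; rewrite ltnn.
  - by move: ab cd; rewrite ac bd => h1 h2; have := ltn_trans h1 h2; rewrite ltnn.
  - by congr inr; apply/val_inj => /=; rewrite ac bd.
by move/leq_card; rewrite card_sum addnn mul2n.
Qed.

Lemma edge_of (i j : 'I_m) : i != j ->
  exists e : edge, forall k, incident k e = (k == i) || (k == j).
Proof.
move=> ij; have [lt|lt|/val_inj eq] := ltngtP i j; last by rewrite eq eqxx in ij.
  by exists (Sub (i, j) lt) => k; rewrite /incident SubK.
by exists (Sub (j, i) lt) => k; rewrite /incident SubK orbC.
Qed.

(** After exchanging the products, each [a e] is counted once for each of the two endpoints of
    [e]. *)
Lemma prod_incident (a : edge -> nat) :
  (\prod_i \prod_(e | incident i e) a e = (\prod_e a e) ^ 2)%N.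
Proof.
rewrite (exchange_big_dep xpredT)//= expnS expn1 -big_split; apply: eq_bigr => e _.
have ne : (val e).2 != (val e).1.
  by rewrite neq_ltn (valP e) orbT.
rewrite (bigD1 (val e).1) /=; last by rewrite /incident eqxx.
rewrite (bigD1 (val e).2) /=; last by rewrite /incident eqxx orbT ne.
by rewrite big1 ?muln1// => i /andP[/andP[/orP[]->]]//=; rewrite ?andbF.
Qed.

(** Bounding [p] by the maximum keeps the predicate boolean; [even_tupleP] removes the bound, since
    a larger prime divides no positive entry. *)
Definition even_tuple (l : 'I_m -> nat) : bool :=
  [forall i, squarefree (l i)] &&
  [forall p : 'I_(\max_i l i).+1,
     prime p ==> ~~ odd #|[set i | (p %| l i)%N]|].

Lemma even_tupleP (l : 'I_m -> nat) :
  reflect ((forall i, squarefree (l i)) /\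
           forall p, prime p -> ~~ odd #|[set i | (p %| l i)%N]|)
          (even_tuple l).
Proof.
apply: (iffP andP) => -[sf ev]; last first.
  by split; apply/forallP => // p; apply/implyP => /ev.
have {}sf := forallP sf; split=> // p pp.
have [pm|pm] := ltnP p (\max_i l i).+1.
  by have /forallP/(_ (Ordinal pm))/implyP := ev; apply.
rewrite (_ : [set i | _] = finset.set0) ?cards0//.
apply/setP => i; rewrite !inE; apply/negP => /dvdn_leq pl.
have /squarefreeP[/pl {}pl _] := sf i.
by have := leq_trans pm (leq_trans pl (leq_bigmax i)); rewrite ltnn.
Qed.

(** Induction on the sum of the entries. A prime [p] dividing some [l i] divides another entry [l j]
    by evenness; dividing both by [p] leaves an even tuple, and [p] is then put back on the edge
    joining [i] and [j]. *)
Lemma even_tuple_factor (l : 'I_m -> nat) : even_tuple l ->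
  exists a : edge -> nat, forall i, l i = (\prod_(e | incident i e) a e)%N.
Proof.
have [N] := ubnP (\sum_i l i)%N.
elim: N l => // N IH l /ltnSE lN /even_tupleP[sf ev].
have [/forallP l1|/forallPn/= [i li]] := boolP [forall i, l i == 1%N].
  by exists (fun=> 1%N) => i; rewrite big1// (eqP (l1 i)).
set p := pdiv (l i).
have l_gt0 k : (0 < l k)%N by have /squarefreeP[] := sf k.
have pp : prime p by rewrite pdiv_prime// ltn_neqAle eq_sym li l_gt0.
have pi : (p %| l i)%N by exact: pdiv_dvd.
pose S q := [set k | (q %| l k)%N].
have [j ij pj] : exists2 j, i != j & (p %| l j)%N.
  have := ev p pp; rewrite -/(S p) (cardsD1 i) inE pi /= negbK => H.
  have /card_gt0P[j] : (0 < #|S p :\ i|)%N by case: #|_| H.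
  by rewrite !inE eq_sym => /andP[? ?]; exists j.
have [e0 e0E] := edge_of ij.
pose l' k := if incident k e0 then (l k %/ p)%N else l k.
have pl k : incident k e0 -> (p %| l k)%N by rewrite e0E => /orP[]/eqP->.
have l'E k : (l k = l' k * (if incident k e0 then p else 1))%N.
  by rewrite /l'; case: ifPn => [/pl/divnK->|]; rewrite ?muln1.
have l'dvd k : (l' k %| l k)%N by rewrite l'E dvdn_mulr.
have [||a aE] := IH l'.
- apply: leq_trans lN; rewrite (bigD1 i)//= [X in (_ < X)%N](bigD1 i)//=.
  rewrite -addSn leq_add//; last by apply: leq_sum => k _; exact: dvdn_leq.
  by rewrite /l' e0E eqxx /= ltn_Pdiv ?prime_gt1.
- apply/even_tupleP; split=> [k|q pq]; first exact: squarefree_dvd (sf k).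
  (* By squarefreeness [p] divides neither new entry, so exactly [i] and [j] leave the set of
     indices for [p] and its parity is kept; for [q] other than [p] the set is unchanged. *)
  have [->|qp] := eqVneq q p.
    have := ev p pp; rewrite -/(S p) (cardsD1 i) inE pi (cardsD1 j) !inE eq_sym ij pj /=.
    rewrite negbK; congr (~~ odd #|pred_of_set _|); apply/setP => k; rewrite !inE.
    rewrite /l' e0E; have [->|ki] := eqVneq k i.
      by rewrite (negPf (squarefree_divp _ _ _))// andbF.
    by have [->|//] := eqVneq k j; rewrite (negPf (squarefree_divp _ _ _)).
  have -> : [set k | (q %| l' k)%N] = S q; last exact: ev.
  apply/setP => k; rewrite !inE [l k]l'E; case: ifP => _; last by rewrite muln1.
  by rewrite Gauss_dvdl// prime_coprime// dvdn_prime2.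
exists (fun e => if e == e0 then a e * p else a e)%N => k.
rewrite l'E aE; case: ifPn => ke.
  rewrite (bigD1 e0)//= [RHS](bigD1 e0)//= eqxx mulnAC; congr (_ * _)%N.
  by apply: eq_bigr => e /andP[_ /negPf->].
by rewrite muln1; apply: eq_bigr => e ie; case: eqP ie ke => // -> ->.
Qed.

End Pairing.

(** A choice of edge labels injects the even tuples into the labellings [a] with labels from 1 to
    [n] and product at most [n ^ k]. Each of these has weight [F a] at least 1, and the sum of [F]
    over all positive labellings factors over the edges into harmonic sums. *)
Lemma card_even_tuple (R : realType) (n k : nat) :
  #|[set l : {ffun 'I_(2 * k) -> 'I_n.+1} | even_tuple (fun i => l i : nat)]|%:R
    <= n%:R ^+ k * (\sum_(1 <= a < n.+1) a%:R^-1) ^+ #|{: edge (2 * k)}| :> R.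
Proof.
set m := (2 * k)%N; set L := [set l | _].
have /choice[phi phiP] : forall l : {ffun 'I_m -> 'I_n.+1},
    exists a : {ffun edge m -> 'I_n.+1}, l \in L ->
      (forall i, l i = (\prod_(e | incident i e) a e)%N :> nat) /\
      (forall e, 0 < a e)%N.
  (* Outside [L] the labelling is a dummy, as [phi] is only used on [L]. *)
  move=> l; have [lL|_] := boolP (l \in L); last by exists [ffun=> ord0].
  have := lL; rewrite inE => ev; have [a aE] := even_tuple_factor ev.
  have adv i e : incident i e -> (a e %| l i)%N.
    by move=> ie; rewrite aE (bigD1 e)//= dvdn_mulr.
  have l0 i : (0 < l i)%N.
    by have /even_tupleP[/(_ i)/squarefreeP[]] := ev.
  have a0 e : (0 < a e)%N.
    by apply: (dvdn_gt0 (l0 (val e).1)); rewrite adv// /incident eqxx.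
  have an e : (a e < n.+1)%N.
    apply: leq_ltn_trans (ltn_ord (l (val e).1)).
    by rewrite dvdn_leq// adv// /incident eqxx.
  exists [ffun e => Ordinal (an e)] => _; split=> [i|e]; last by rewrite ffunE a0.
  by rewrite aE; apply: eq_bigr => e _; rewrite ffunE.
have phi_inj : {in L &, injective phi}.
  move=> l l' /phiP[+ _] /phiP[+ _] eq; rewrite eq => h h'.
  by apply/ffunP => i; apply: val_inj; rewrite /= h h'.
pose F (a : {ffun edge m -> 'I_n.+1}) : R := n%:R ^+ k * \prod_e (a e)%:R^-1.
have F0 a : 0 <= F a.
  by rewrite mulr_ge0 ?exprn_ge0// prodr_ge0// => e _; rewrite invr_ge0.
apply: (@le_trans _ _ (\sum_(l in L) F (phi l))).
  rewrite -sum1_card natr_sum; apply: ler_sum => l lL.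
  have [lE a0] := phiP l lL.
  (* Compare squares: the square of the product of the labels is the product of the [2k] entries,
     each at most [n]. *)
  have ale : (\prod_e phi l e <= n ^ k)%N.
    rewrite -leq_sqr -prod_incident -expnM mulnC.
    rewrite (eq_bigr (fun i => l i : nat)); last by move=> i _; rewrite lE.
    have -> : (n ^ (2 * k) = \prod_(i < m) n)%N by rewrite prod_nat_const card_ord.
    by apply: leq_prod => i _; rewrite -ltnS ltn_ord.
  rewrite /F prodfV -natr_prod ler_pdivlMr ?mul1r ?ltr0n ?prodn_gt0//.
  by rewrite -natrX ler_nat.
rewrite -(big_imset F phi_inj) /=.
apply: (@le_trans _ _ (\sum_(a in ffun_on [pred x : 'I_n.+1 | (0 < x)%N]) F a)).
  rewrite big_mkcond [leRHS]big_mkcond; apply: ler_sum => a _.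
  case: ifPn => [/imsetP[l lL ->]|_]; last by case: ifP.
  have [_ a0] := phiP l lL.
  by rewrite ifT//; apply/ffun_onP => e; exact: a0.
rewrite -mulr_sumr ler_wpM2l ?exprn_ge0//.
rewrite -(bigA_distr_big _ (fun _ (x : 'I_n.+1) => (x%:R^-1 : R))) /= prodr_const.
apply: lerXn2r; [by rewrite nnegrE sumr_ge0|by rewrite nnegrE sumr_ge0|].
rewrite big_add1 big_mkord.
rewrite big_mkcond big_ord_recl /= add0r.
by rewrite le_eqVlt; apply/orP; left; apply/eqP; apply: eq_bigr => i _.
Qed.

(** * Estimates for the harmonic sum and for [M_seq] *)

Local Open Scope classical_set_scope.
Local Open Scope ring_scope.

(** The induction step is [ln (1 - x) <= - x] at the reciprocal [x] of the new index. *)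
Lemma sum_inv_le_ln (R : realType) (n : nat) : (0 < n)%N ->
  \sum_(1 <= a < n.+1) (a%:R^-1 : R) <= 1 + ln n%:R.
Proof.
case: n => // n _; elim: n => [|n IH]; first by rewrite big_nat1 invr1 ln1 addr0.
rewrite big_nat_recr//=; apply: le_trans (lerD IH (lexx _)) _.
rewrite -addrA lerD2l -lerBrDl -opprB -lerN2 opprK -ln_div ?posrE ?ltr0n//.
have -> : (n.+1%:R / n.+2%:R = 1 + - n.+2%:R^-1 :> R).
  have z : n.+2%:R != 0 :> R by rewrite pnatr_eq0.
  by apply: (mulIf z); rewrite divfK// mulrDl mul1r mulNr mulVf// -(natr1 n.+1) addrK.
apply: le_ln1Dx; rewrite ltrN2 invf_lt1 ?ltr0n// ltr1n//.
Qed.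

(** From [ln y - ln x <= y / x - 1 <= (y / x - 1) * ln x] one gets [ln y <= (y / x) * ln x]. It is
    applied to [ln l] and [ln n], to compare the exponents in [M_seq]. *)
Lemma ln_div_ln_mono (R : realType) (x y : R) :
  0 < x -> 1 <= ln x -> x <= y -> x / ln x <= y / ln y.
Proof.
move=> x0 lx xy; have y0 : 0 < y by exact: lt_le_trans xy.
have ly : ln x <= ln y by rewrite ler_ln ?posrE.
have lx0 : 0 < ln x by exact: lt_le_trans lx.
have ly0 : 0 < ln y by exact: lt_le_trans ly.
rewrite ler_pdivrMr// mulrAC ler_pdivlMr//.
have H : ln y - ln x <= y / x - 1.
  rewrite -ln_div ?posrE//; have {1}-> : y / x = 1 + (y / x - 1) by rewrite addrC subrK.
  by apply: le_ln1Dx; rewrite ltrBrDr addNr divr_gt0.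
have H2 : y / x - 1 <= (y / x - 1) * ln x.
  by rewrite ler_peMr// subr_ge0 ler_pdivlMr// mul1r.
have := le_trans H H2; rewrite mulrBl mul1r lerD2r => H3.
have := ler_wpM2l (ltW x0) H3; rewrite mulrA [x * (y / x)]mulrC divfK ?gt_eqF//.
Qed.

Lemma omega_le (l : nat) : (omega l <= l)%N.
Proof.
rewrite /omega -[leqRHS](size_iota 1); apply: uniq_leq_size (primes_uniq l) _ => p.
rewrite mem_primes mem_iota add1n ltnS => /and3P[pp l0 /dvdn_leq ->]//.
by rewrite prime_gt0.
Qed.

(** For large [l] the bound on [omega l] and the monotonicity of the exponent give the claim with
    constant 1. The finitely many smaller [l] are absorbed into [K]. *)
Lemma pow_omega_le_M_seq (R : realType) (M c : R) :
  (\forall l \near \oo, (omega l)%:R <= c * ln (l%:R : R) / ln (ln (l%:R : R))) ->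
  exists2 K : R, 0 <= K & forall n l, (2 <= n)%N -> (l <= n)%N ->
    Num.max M 1 ^+ omega l <= K * M_seq M c n.
Proof.
move=> c_omega; set B := Num.max M 1.
have B1 : 1 <= B by rewrite le_max lexx orbT.
have B0 : 0 < B by exact: lt_le_trans B1.
have lnoo : \forall l \near \oo, 1 <= ln (ln (l%:R : R)).
  exists (Num.truncn (expR (expR (1 : R)))).+1 => // l /= ll.
  have el : expR (expR 1) <= l%:R :> R.
    by apply: le_trans (ltW (truncnS_gt _)) _; rewrite ler_nat.
  have l0 : 0 < l%:R :> R by apply: lt_le_trans el; exact: expR_gt0.
  have e1 : expR 1 <= ln l%:R :> R by rewrite -ler_expR lnK ?posrE.
  by rewrite -ler_expR lnK// posrE; apply: lt_le_trans e1; exact: expR_gt0.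
have [N _ NP] : \forall l \near \oo, 1 <= ln (ln (l%:R : R)) /\
    (omega l)%:R <= c * ln (l%:R : R) / ln (ln (l%:R : R)).
  by near=> l; split; near: l.
have M_gt0 n : 0 < M_seq M c n by rewrite powR_gt0.
have M_ge1 n : (N <= n)%N -> 1 <= M_seq M c n.
  move=> Nn; have [_] := NP n Nn; rewrite /M_seq -/B => h.
  by rewrite -[leLHS](powRr0 B); apply: ler_powR => //; exact: le_trans (ler0n _ _) h.
(* [B ^+ N] dominates the left side for [l < N]. The factor after it makes up for [M_seq M c n]
   possibly being below 1 when [n < N]: the term [j = n] then cancels it. *)
exists (B ^+ N * (1 + \sum_(j < N) (M_seq M c j)^-1)).
  by rewrite mulr_ge0 ?exprn_ge0 ?(ltW B0)// addr_ge0// sumr_ge0// => j _; rewrite invr_ge0 ltW.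
move=> n l n2 len.
have BN : 1 <= B ^+ N by rewrite exprn_ege1.
have S0 : 0 <= \sum_(j < N) (M_seq M c j)^-1 by apply: sumr_ge0 => j _; rewrite invr_ge0 ltW.
have [lN|Nl] := ltnP l N.
  have : B ^+ omega l <= B ^+ N.
    by apply: ler_weXn2l => //; exact: leq_trans (omega_le l) (ltnW lN).
  move=> /le_trans; apply; rewrite -mulrA ler_peMr ?(le_trans ler01 BN)//.
  have [nN|Nn] := ltnP n N.
    rewrite mulrDl mul1r (bigD1 (Ordinal nN))//= mulrDl mulVf ?gt_eqF//.
    rewrite addrCA lerDl// addr_ge0 ?(ltW (M_gt0 n))// mulr_ge0 ?(ltW (M_gt0 n))//.
    by apply: sumr_ge0 => j _; rewrite invr_ge0 ltW.
  by rewrite mulrDl mul1r (le_trans (M_ge1 n Nn))// lerDl mulr_ge0// (ltW (M_gt0 n)).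
have Nn := leq_trans Nl len.
have [ll1 lo] := NP l Nl; have [nn1 _] := NP n Nn.
have lnl0 : 0 < ln l%:R :> R.
  by rewrite ltNge; apply/negP => /ln0 l0; move: ll1; rewrite l0 ler10.
have l0 : (0 < l)%N.
  by rewrite lt0n; apply/eqP => l0; move: lnl0; rewrite l0 ln0 ?ltxx.
(* No sign of [c] is assumed; it follows from [omega l >= 0] and the positivity of both logarithms
   at [l]. *)
have c0 : 0 <= c.
  have := le_trans (ler0n _ _) lo; rewrite -mulrA pmulr_lge0//.
  by rewrite divr_gt0// (lt_le_trans _ ll1).
have h : B ^+ omega l <= M_seq M c n.
  rewrite -powR_mulrn ?(ltW B0)// /M_seq -/B ler_powR//.
  apply: le_trans lo _; rewrite -!mulrA ler_wpM2l//.
  by apply: ln_div_ln_mono => //; rewrite ler_ln ?posrE ?ltr0n ?ler_nat// (leq_trans l0).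
apply: le_trans h _; rewrite ler_peMl ?(ltW (M_gt0 n))//.
rewrite -[X in X <= _]mulr1; apply: ler_pM => //.
by rewrite lerDl.
Unshelve. all: by end_near. Qed.

(** * Bounded measurable functions *)

Section BoundedMeasurable.
Context (d : measure_display) (T : measurableType d) (R : realType).

(** A class closed under sums, products and composition with random variables, and integrable for
    every probability, so that linearity of the integral applies throughout. *)
Definition bounded_mfun (f : T -> R) : Prop :=
  measurable_fun [set: T] f /\ exists K, forall w, `|f w| <= K.

Lemma bounded_mfun_cst (r : R) : bounded_mfun (cst r).
Proof. by split; [exact: measurable_cst|exists `|r|]. Qed.

Lemma bounded_mfun_indic (A : set T) : measurable A -> bounded_mfun \1_A.
Proof.
move=> mA; split; first exact: measurable_indic.
by exists 1 => w; rewrite indicE; case: (_ \in _); rewrite ?normr1 ?normr0.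
Qed.

Lemma bounded_mfunD (f g : T -> R) : bounded_mfun f -> bounded_mfun g ->
  bounded_mfun (fun w => f w + g w).
Proof.
move=> [mf [K fK]] [mg [L gL]]; split; first exact: measurable_funD.
by exists (K + L) => w; rewrite (le_trans (ler_normD _ _))// lerD.
Qed.

Lemma bounded_mfunM (f g : T -> R) : bounded_mfun f -> bounded_mfun g ->
  bounded_mfun (fun w => f w * g w).
Proof.
move=> [mf [K fK]] [mg [L gL]]; split; first exact: measurable_funM.
by exists (K * L) => w; rewrite normrM ler_pM.
Qed.

Lemma bounded_mfunB (f g : T -> R) : bounded_mfun f -> bounded_mfun g ->
  bounded_mfun (fun w => f w - g w).
Proof.
move=> [mf [K fK]] [mg [L gL]]; split; first exact: measurable_funB.
by exists (K + L) => w; rewrite (le_trans (ler_normB _ _))// lerD.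
Qed.

Lemma bounded_mfun_norm (f : T -> R) : bounded_mfun f ->
  bounded_mfun (fun w => `|f w|).
Proof.
move=> [mf [K fK]]; split; first exact: measurableT_comp.
by exists K => w; rewrite normr_id.
Qed.

Lemma bounded_mfun_sum (I : Type) (s : seq I) (f : I -> T -> R) :
  (forall i, bounded_mfun (f i)) -> bounded_mfun (fun w => \sum_(i <- s) f i w).
Proof.
move=> bf; elim: s => [|i s IH].
  by under eq_fun do rewrite big_nil; exact: bounded_mfun_cst.
by under eq_fun do rewrite big_cons; exact: bounded_mfunD.
Qed.

Lemma bounded_mfun_prod (I : Type) (s : seq I) (f : I -> T -> R) :
  (forall i, bounded_mfun (f i)) -> bounded_mfun (fun w => \prod_(i <- s) f i w).
Proof.
move=> bf; elim: s => [|i s IH].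
  by under eq_fun do rewrite big_nil; exact: bounded_mfun_cst.
by under eq_fun do rewrite big_cons; exact: bounded_mfunM.
Qed.

Lemma bounded_mfunX (f : T -> R) (e : nat) : bounded_mfun f ->
  bounded_mfun (fun w => f w ^+ e).
Proof.
move=> bf; elim: e => [|e IH].
  by under eq_fun do rewrite expr0; exact: bounded_mfun_cst.
by under eq_fun do rewrite exprS; exact: bounded_mfunM.
Qed.

Lemma bounded_mfun_integrable (P : probability T R) (f : T -> R) :
  bounded_mfun f -> P.-integrable [set: T] (EFin \o f).
Proof.
move=> [mf [K fK]]; apply: measurable_bounded_integrable => //.
  by rewrite (le_lt_trans (probability_le1 P measurableT))// ltry.
exists K; split; first exact: num_real.
by move=> L KL w _; rewrite /= (le_trans (fK w))// ltW.
Qed.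

End BoundedMeasurable.

Lemma bounded_mfun_comp (d d' : measure_display) (T : measurableType d)
    (U : measurableType d') (R : realType) (f : U -> R) (X : T -> U) :
  bounded_mfun f -> measurable_fun [set: T] X -> bounded_mfun (fun w => f (X w)).
Proof.
by move=> [mf [K fK]] mX; split; [exact: measurableT_comp|exists K].
Qed.

(** * Expectations of products of independent variables and of odd functions of symmetric ones *)

Section Expectation.
Context (d : measure_display) (T : measurableType d) (R : realType).
Variable P : probability T R.

Lemma Rintegral_sum (I : Type) (s : seq I) (f : I -> T -> R) :
  (forall i, bounded_mfun (f i)) ->
  \int[P]_w (\sum_(i <- s) f i w) = \sum_(i <- s) \int[P]_w f i w.
Proof.
move=> bf; elim: s => [|i s IH].
  rewrite big_nil; under eq_Rintegral do rewrite big_nil.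
  by rewrite Rintegral_cst// mul0r.
rewrite big_cons -IH -RintegralD//; last 2 first.
- exact: bounded_mfun_integrable.
- by apply: bounded_mfun_integrable; exact: bounded_mfun_sum.
by apply: eq_Rintegral => w _; rewrite big_cons.
Qed.

Lemma Rintegral_indic_comp (X : {RV P >-> R}) (A : set R) : measurable A ->
  \int[P]_w \1_A (X w) = fine (P (X @^-1` A)).
Proof.
move=> mA; rewrite /Rintegral.
rewrite (eq_integral (fun w => (\1_(X @^-1` A) w)%:E)); last by [].
by rewrite integral_indic ?setIT// -[X in measurable X]setTI; exact: measurable_funPT.
Qed.

Import HBSimple.

(** A simple function is a finite combination of indicators of its level sets, and both sides are
    linear in [f]. *)
Lemma Rintegral_factor_sfun (X : {RV P >-> R}) (G : T -> R) (c : R)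
    (f : {sfun R >-> R}) : bounded_mfun G ->
  (forall A : set R, measurable A ->
     \int[P]_w (\1_A (X w) * G w) = c * \int[P]_w \1_A (X w)) ->
  \int[P]_w (f (X w) * G w) = c * \int[P]_w f (X w).
Proof.
move=> bG GP.
have mf y : measurable (f @^-1` [set y]) by exact: measurable_sfunP.
have bi y : bounded_mfun (fun w => \1_(f @^-1` [set y]) (X w) : R).
  by apply: bounded_mfun_comp => //; exact: bounded_mfun_indic.
have fE x : f x = \sum_(y <- finmap.enum_fset (fset_set (range f)))
    y * \1_(f @^-1` [set y]) x.
  by rewrite {1}fimfunE fsbig_finite//; exact: fimfunP.
under eq_Rintegral do rewrite fE mulr_suml.
rewrite Rintegral_sum; last first.
  move=> y; apply: bounded_mfunM => //; apply: bounded_mfunM => //.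
  exact: bounded_mfun_cst.
under [in RHS]eq_Rintegral do rewrite fE.
rewrite Rintegral_sum; last first.
  by move=> y; apply: bounded_mfunM => //; exact: bounded_mfun_cst.
rewrite mulr_sumr; apply: eq_bigr => y _.
under eq_Rintegral do rewrite -mulrA.
rewrite !RintegralZl//; last 2 first.
- exact: bounded_mfun_integrable.
- by apply: bounded_mfun_integrable; exact: bounded_mfunM.
by rewrite GP// mulrCA.
Qed.

(** With [c] the expectation of [G], this extends the factorisation of expectations from events of
    [X] to bounded functions of [X]. *)
Lemma Rintegral_factor (X : {RV P >-> R}) (G : T -> R) (c : R) (f : R -> R) :
  bounded_mfun G ->
  (forall A : set R, measurable A ->
     \int[P]_w (\1_A (X w) * G w) = c * \int[P]_w \1_A (X w)) ->
  bounded_mfun f ->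
  \int[P]_w (f (X w) * G w) = c * \int[P]_w f (X w).
Proof.
move=> bG GP bf; have [mG [K GK]] := bG.
have int := @bounded_mfun_integrable _ _ _ P.
have mX : measurable_fun [set: T] X by exact: measurable_funPT.
have [g [_ _]] := approximation_sfun_integrable measurableT
  (bounded_mfun_integrable (distribution P X) bf).
have bg n : bounded_mfun (g n).
  split; first exact: measurable_funPT.
  have [L [_ gL]] := simple_bounded (g n).
  by exists (L + 1) => x; apply: gL => //; rewrite ltrDl.
have bfX : bounded_mfun (fun w => f (X w)) by exact: bounded_mfun_comp.
have bgX n : bounded_mfun (fun w => g n (X w)) by exact: bounded_mfun_comp.
pose a n := \int[P]_w `|f (X w) - g n (X w)|.
have ba n : bounded_mfun (fun w => `|f (X w) - g n (X w)|).
  by apply: bounded_mfun_norm; exact: bounded_mfunB.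
(* The approximation holds in L^1 of the law of [X]; a change of variables turns its error into
   [a n]. *)
rewrite (_ : (fun n => _) = (fun n => (a n)%:E)); last first.
  apply/funext => n.
  rewrite (integral_distribution (f := fun z => `|(EFin \o f) z - (g n z)%:E|%E)); last 2 first.
  - apply/measurable_EFinP; apply: measurableT_comp => //.
    by apply: measurable_funB; [case: bf|case: (bg n)].
  - exact: int (ba n).
  by rewrite /a /Rintegral fineK//; exact: integrable_fin_num (int _ (ba n)).
move=> /fine_cvgP[_] /= a0.
apply/eqP; rewrite -subr_eq0 -normr_eq0; apply/eqP/le_anti; rewrite normr_ge0 andbT.
(* L^1 approximation by simple functions; G bounded makes the error O(a n). *)
have h : (K + `|c|) * a n @[n --> \oo] --> (K + `|c|) * 0 by apply: cvgMr.
rewrite mulr0 in h.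
apply: (ler_cvg_to (cvg_cst _) h); apply: nearW => n.
(* The same difference with [g n] in place of [f] is zero by the simple case, so it may be
   subtracted. *)
have -> : \int[P]_w (f (X w) * G w) - c * \int[P]_w f (X w) =
    \int[P]_w ((f (X w) - g n (X w)) * G w) - c * \int[P]_w (f (X w) - g n (X w)).
  rewrite [in RHS]RintegralB ?int//.
  under [in RHS]eq_Rintegral do rewrite mulrBl.
  rewrite RintegralB; [|by []|exact: int (bounded_mfunM _ _)|exact: int (bounded_mfunM _ _)].
  rewrite (Rintegral_factor_sfun _ bG GP) mulrBr.
  by rewrite [in RHS]opprB addrA addrNK.
rewrite (le_trans (ler_normB _ _))// mulrDl lerD//; last first.
  rewrite normrM ler_wpM2l//; apply: le_normr_Rintegral => //.
  by apply: int; exact: bounded_mfunB.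
have bfg : bounded_mfun (fun w => f (X w) - g n (X w)) by exact: bounded_mfunB.
apply: le_trans (le_normr_Rintegral _ _) _ => //.
  by apply: int; exact: bounded_mfunM.
rewrite /a -RintegralZl//; last exact: int (ba n).
apply: le_Rintegral => //.
- by apply: int; apply: bounded_mfun_norm; exact: bounded_mfunM.
- by apply: int; apply: bounded_mfunM => //; exact: bounded_mfun_cst.
by move=> w _; rewrite normrM mulrC ler_wpM2r.
Qed.

(** The product of indicators is the indicator of an intersection of preimages, to which the
    definition of independence applies. *)
Lemma independent_RVs_prod_indic (D : pred nat) (X : nat -> {RV P >-> R})
    (s : seq nat) (A : nat -> set R) :
  independent_RVs D X -> uniq s -> all D s -> (forall i, measurable (A i)) ->
  \int[P]_w (\prod_(i <- s) \1_(A i) (X i w)) =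
  \prod_(i <- s) \int[P]_w \1_(A i) (X i w).
Proof.
move=> indep us Ds mA.
have mXA i : measurable (X i @^-1` A i).
  by rewrite -[Y in measurable Y]setTI; exact: measurable_funPT.
have E w : \prod_(i <- s) \1_(A i) (X i w) =
    \1_(\bigcap_(i in [set` s]) (X i @^-1` A i)) w :> R.
  rewrite indicE; case: (boolP (w \in _)) => [|/negP]; rewrite inE => H.
    rewrite big_seq big1// => i si; rewrite indicE mem_set//; exact: (H i).
  have [i si nA] : exists2 i, i \in s & ~ A i (X i w).
    apply: contra_notP H => H i si; apply: contrapT => nA; apply: H.
    by exists i.
  by rewrite (bigD1_seq i)//= indicE memNset// mul0r.
under eq_Rintegral do rewrite E.
rewrite /Rintegral integral_indic//; last exact: bigcap_measurableType.
rewrite setIT; transitivity (fine (\prod_(i <- s) P (X i @^-1` A i))%E).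
  by congr fine; exact: indep.
under [in RHS]eq_bigr do rewrite -/(Rintegral _ _ _) Rintegral_indic_comp//.
elim: s {us Ds E} => [|i s IH]; first by rewrite !big_nil.
rewrite !big_cons fineM ?IH//; first exact: fin_num_measure.
by apply: prode_fin_num => j _; exact: fin_num_measure.
Qed.

(* Indicators are replaced by general functions one at a time: the induction moves
   indices from [s] to [t], with arbitrary sets. *)
Lemma independent_RVs_prod_mix (D : pred nat) (X : nat -> {RV P >-> R})
    (s t : seq nat) (A : nat -> set R) (f : nat -> R -> R) :
  independent_RVs D X -> uniq (t ++ s) -> all D (t ++ s) ->
  (forall i, measurable (A i)) -> (forall i, bounded_mfun (f i)) ->
  \int[P]_w (\prod_(i <- t) \1_(A i) (X i w) * \prod_(i <- s) f i (X i w)) =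
  \prod_(i <- t) \int[P]_w \1_(A i) (X i w) *
  \prod_(i <- s) \int[P]_w f i (X i w).
Proof.
move=> indep + + + bf; elim: s t A => [|p s IH] t A.
  rewrite cats0 big_nil mulr1 => ut Dt mA.
  rewrite -(independent_RVs_prod_indic indep ut)//.
  by apply: eq_Rintegral => w _; rewrite big_nil mulr1.
move=> uts Dts mA; rewrite big_cons.
under eq_Rintegral do rewrite big_cons mulrCA.
have bfX i : bounded_mfun (fun w => f i (X i w)).
  by apply: bounded_mfun_comp => //; exact: measurable_funPT.
have pt : p \notin t.
  by move: uts; rewrite cat_uniq /= => /and3P[_ + _]; rewrite negb_or => /andP[].
rewrite (Rintegral_factor (c := \prod_(i <- t) \int[P]_w \1_(A i) (X i w) *
  \prod_(i <- s) \int[P]_w f i (X i w)))//; first by rewrite mulrAC mulrA.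
- apply: bounded_mfunM; last exact: bounded_mfun_prod.
  apply: bounded_mfun_prod => i; apply: bounded_mfun_comp.
    exact: bounded_mfun_indic.
  exact: measurable_funPT.
(* The condition on indicators is the induction hypothesis with [p] moved to the first list and
   given the set [B]; since [p] is not in [t], the other sets stay the same. *)
move=> B mB; pose A' i := if i == p then B else A i.
have eA' i : i \in t -> A' i = A i.
  by rewrite /A'; case: eqP => // -> it; rewrite it in pt.
have uts' : uniq ((p :: t) ++ s).
  by move: uts; rewrite (perm_uniq (permEl (perm_catCA t [:: p] s))).
have Dts' : all D ((p :: t) ++ s).
  by move: Dts; rewrite /= !all_cat /= => /and3P[-> -> ->].
have mA' i : measurable (A' i) by rewrite /A'; case: eqP.
have := IH (p :: t) A' uts' Dts' mA'; rewrite !big_cons {2}/A' eqxx.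
rewrite (eq_big_seq (fun i => \int[P]_w \1_(A i) (X i w))); last first.
  by move=> i it; rewrite eA'.
rewrite -mulrA [X in _ = X -> _]mulrC => <-.
apply: eq_Rintegral => w _; rewrite big_cons {1}/A' eqxx -mulrA.
by congr (_ * (_ * _)); apply: eq_big_seq => i it; rewrite eA'.
Qed.

Lemma independent_RVs_prod (D : pred nat) (X : nat -> {RV P >-> R})
    (s : seq nat) (f : nat -> R -> R) :
  independent_RVs D X -> uniq s -> all D s -> (forall i, bounded_mfun (f i)) ->
  \int[P]_w (\prod_(i <- s) f i (X i w)) =
  \prod_(i <- s) \int[P]_w f i (X i w).
Proof.
move=> indep us Ds bf.
have := independent_RVs_prod_mix (t := [::]) (A := fun=> setT) indep us Ds
  (fun=> measurableT) bf.
rewrite big_nil mul1r => <-.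
by apply: eq_Rintegral => w _; rewrite big_nil mul1r.
Qed.

(** [X] and [- X] have the same law, so the expectation equals its own opposite. *)
Lemma symmetric_RV_odd (X : {RV P >-> R}) (f : R -> R) :
  symmetric_RV X -> bounded_mfun f -> (forall x, f (- x) = - f x) ->
  \int[P]_w f (X w) = 0.
Proof.
move=> symX bf oddf; have [mf _] := bf.
have mX : measurable_fun [set: T] X by exact: measurable_funPT.
have bfX : bounded_mfun (fun w => f (X w)) by exact: bounded_mfun_comp.
pose Y : {RV P >-> R} := (\- X)%R.
have bfY : bounded_mfun (fun w => f (Y w)).
  by apply: bounded_mfun_comp => //; exact: measurable_funPT.
have fX : \int[P]_w f (X w) = \int[P]_w f (Y w).
  rewrite /Rintegral; congr fine.
  have mEf : measurable_fun setT (EFin \o f) by exact/measurable_EFinP.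
  have -> : (\int[P]_w (f (X w))%:E = \int[distribution P X]_y (EFin \o f) y)%E.
    by rewrite integral_distribution//; exact: bounded_mfun_integrable.
  have -> : (\int[P]_w (f (Y w))%:E = \int[distribution P Y]_y (EFin \o f) y)%E.
    by rewrite integral_distribution//; exact: bounded_mfun_integrable.
  by apply: eq_measure_integral => A mA _; exact: symX.
have : \int[P]_w f (Y w) = - \int[P]_w f (X w).
  rewrite -mulN1r -RintegralZl//; last exact: bounded_mfun_integrable.
  by apply: eq_Rintegral => w _; rewrite mulN1r -oddf.
by rewrite -fX => h; lra.
Qed.

End Expectation.

(** * Moments of the partial sums of the truncated multiplicative function *)

Section Truncation.
Context (d : measure_display) (T : measurableType d) (R : realType).
Variables (P : probability T R) (X : nat -> {RV P >-> R}) (B : R).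
Hypothesis B1 : 1 <= B.

(* Truncation makes the X_p, bounded only almost surely, bounded everywhere. *)
Definition trunc_id (x : R) : R := \1_[set` `[- B, B]] x * x.

Lemma trunc_id_le (x : R) : `|trunc_id x| <= B.
Proof.
rewrite /trunc_id indicE mem_setE in_itv /= -ler_norml.
by case: (boolP (`|x| <= B)) => h; rewrite ?mul1r// mul0r normr0 (le_trans ler01).
Qed.

Lemma trunc_idE (x : R) : `|x| <= B -> trunc_id x = x.
Proof. by move=> h; rewrite /trunc_id indicE mem_setE in_itv /= -ler_norml h mul1r. Qed.

Lemma trunc_idN (x : R) : trunc_id (- x) = - trunc_id x.
Proof. by rewrite /trunc_id !indicE !mem_setE !in_itv /= -!ler_norml normrN mulrN. Qed.

Lemma bounded_mfun_trunc_id : bounded_mfun trunc_id.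
Proof.
split; last by exists B; exact: trunc_id_le.
apply: measurable_funM; last exact: measurable_id.
by apply: measurable_indic; exact: measurable_itv.
Qed.

Definition theta_trunc (l : nat) (w : T) : R :=
  if squarefree l then \prod_(p <- primes l) trunc_id (X p w) else 0.

Lemma bounded_mfun_theta_trunc (l : nat) : bounded_mfun (theta_trunc l).
Proof.
rewrite /theta_trunc; case: (squarefree l); last exact: bounded_mfun_cst.
apply: bounded_mfun_prod => p; apply: bounded_mfun_comp (measurable_funPT _).
exact: bounded_mfun_trunc_id.
Qed.

Lemma theta_trunc_le (l : nat) (w : T) : `|theta_trunc l w| <= B ^+ omega l.
Proof.
have B0 : 0 <= B by exact: le_trans B1.
rewrite /theta_trunc; case: ifP => _; last by rewrite normr0 exprn_ge0.
rewrite normr_prod /omega; elim: (primes l) => [|p s IH]; first by rewrite big_nil.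
by rewrite big_cons exprS ler_pM ?normr_ge0 ?trunc_id_le// -normr_prod.
Qed.

(** Gives all [l] up to [n] one common list of primes, so that products over primes and over tuple
    indices can be exchanged. *)
Lemma prod_primes_widen (n l : nat) (F : nat -> R) : (0 < l <= n)%N ->
  \prod_(p <- primes l) F p =
  \prod_(p <- [seq q <- iota 0 n.+1 | prime q] | (p %| l)%N) F p.
Proof.
move=> /andP[l0 ln]; rewrite -[RHS]big_filter -filter_predI; apply: perm_big.
apply: uniq_perm; [exact: primes_uniq|by rewrite filter_uniq ?iota_uniq|move=> p].
rewrite mem_primes mem_filter mem_iota /= add0n l0 /= andbC.
have [pl|//] := boolP (p %| l)%N.
by rewrite ltnS (leq_trans (dvdn_leq l0 pl) ln) /= andbT.
Qed.

Hypothesis X_indep : independent_RVs prime X.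
Hypothesis X_sym : forall p : nat, prime p -> symmetric_RV (X p).

(** A non-squarefree entry makes the product zero. Otherwise some prime [p] divides an odd number of
    entries; collecting the factors by primes, independence splits off the expectation of an odd
    power of the truncated [X p], which vanishes by symmetry. *)
Lemma Rintegral_theta_trunc_odd (n m : nat) (l : 'I_m -> nat) :
  (forall i, l i <= n)%N -> ~~ even_tuple l ->
  \int[P]_w \prod_(i < m) theta_trunc (l i) w = 0.
Proof.
move=> ln ev.
have [/forallP sf|/forallPn[i /negPf nsf]] := boolP [forall i, squarefree (l i)]; last first.
  rewrite -[RHS](mul0r (fine (P setT))) -Rintegral_cst//.
  apply: eq_Rintegral => w _; rewrite (bigD1 i)//= {1}/theta_trunc nsf.
  by rewrite mul0r.
have [p pp podd] : exists2 p, prime p & odd #|finset.finset (fun i => p %| l i)%N|.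
  apply: contrapT => H; move/negP: ev; apply; apply/even_tupleP; split=> // p pp.
  by apply/negP => podd; apply: H; exists p.
set r := [seq q <- iota 0 n.+1 | prime q].
pose e q := #|finset.finset (fun i => q %| l i)%N|.
have pr : p \in r.
  have /card_gt0P[i] : (0 < e p)%N by rewrite /e; case: #|_| podd.
  rewrite finset.inE => /dvdn_leq pl; rewrite mem_filter pp mem_iota add0n ltnS /=.
  by apply: leq_trans (ln i); apply: pl; have /squarefreeP[] := sf i.
have ur : uniq r by rewrite filter_uniq ?iota_uniq.
under eq_Rintegral => w _.
  rewrite (_ : \prod_(i < m) _ = \prod_(q <- r) (trunc_id (X q w) ^+ e q)); last first.
    rewrite (eq_bigr (fun i => \prod_(q <- r | (q %| l i)%N) trunc_id (X q w))).
      rewrite (exchange_big_dep xpredT)//=; apply: eq_bigr => q _.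
      rewrite prodr_const /e; congr (_ ^+ _); apply: eq_card => i.
      by rewrite finset.inE.
    move=> i _; rewrite /theta_trunc sf (@prod_primes_widen n)//.
    by rewrite ln andbT; have /squarefreeP[] := sf i.
  over.
rewrite (independent_RVs_prod (f := fun q x => trunc_id x ^+ e q) X_indep ur).
- rewrite (bigD1_seq p)//= (symmetric_RV_odd (f := fun x => trunc_id x ^+ e p)) ?mul0r//.
  + exact: X_sym.
  + by apply: bounded_mfunX; exact: bounded_mfun_trunc_id.
  + by move=> x; rewrite trunc_idN exprNn -signr_odd podd expr1 mulN1r.
- by apply/allP => q; rewrite mem_filter => /andP[].
- by move=> q; apply: bounded_mfunX; exact: bounded_mfun_trunc_id.
Qed.

Lemma Rintegral_partial_sum_trunc (n k : nat) (K : R) : 0 <= K ->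
  (forall l, (l <= n)%N -> B ^+ omega l <= K) ->
  \int[P]_w ((\sum_(1 <= l < n.+1) theta_trunc l w) ^+ (2 * k)) <=
  #|finset.finset (fun l : {ffun 'I_(2 * k) -> 'I_n.+1} =>
      even_tuple (fun i => l i : nat))|%:R * K ^+ (2 * k).
Proof.
move=> K0 BK; set m := (2 * k)%N.
have bth l : bounded_mfun (theta_trunc l) := bounded_mfun_theta_trunc l.
under eq_Rintegral => w _.
  rewrite (_ : _ ^+ _ = \sum_(l : {ffun 'I_m -> 'I_n.+1})
      \prod_(i < m) theta_trunc (l i) w); last first.
    (* The index type also contains 0, which contributes nothing because 0 is not squarefree. *)
    rewrite -(bigA_distr_bigA (fun (i : 'I_m) (l : 'I_n.+1) => theta_trunc l w)).
    rewrite prodr_const card_ord big_add1 big_mkord /= [in RHS]big_ord_recl.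
    by rewrite {2}/theta_trunc /= add0r.
  over.
rewrite Rintegral_sum; last by move=> l; exact: bounded_mfun_prod.
rewrite -sum1_card natr_sum mulr_suml big_mkcond [leRHS]big_mkcond /=.
apply: ler_sum => l _; rewrite finset.inE mul1r; case: ifPn => [_|ev]; last first.
  rewrite (@Rintegral_theta_trunc_odd n)// => i.
  by rewrite -ltnS ltn_ord.
have <- : \int[P]_w (K ^+ m) = K ^+ m.
  rewrite Rintegral_cst// (_ : fine _ = 1) ?mulr1//.
  by have := @probability_setT _ _ _ P => /= ->.
apply: le_Rintegral => //.
- by apply: bounded_mfun_integrable; exact: bounded_mfun_prod.
- exact: bounded_mfun_integrable (bounded_mfun_cst _ _).
move=> w _; apply: le_trans (ler_norm _) _; rewrite normr_prod.
rewrite -[m in leRHS]card_ord -prodr_const; apply: ler_prod => i _.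
rewrite normr_ge0 /=; apply: le_trans (theta_trunc_le _ _) (BK _ _).
by rewrite -ltnS ltn_ord.
Qed.

End Truncation.

(** * Passage from the truncated to the original variables, and conclusion *)

Lemma supLoo_ae_le (d : measure_display) (T : measurableType d) (R : realType)
    (P : probability T R) (X : nat -> {RV P >-> R}) (M : R) :
  supLoo X = M%:E ->
  {ae P, forall w, forall p, prime p -> `|X p w| <= M}.
Proof.
move=> XM; apply/ae_foralln => p.
have [pp|npp] := boolP (prime p); last by apply: nearW.
have : (Lnorm P +oo (EFin \o X p) <= M%:E)%E.
  by rewrite -XM; apply: ereal_sup_ubound; exists p.
(* The L^oo norm is defined as an essential supremum only for a measure of positive total mass. *)
rewrite unlock ifT; last by rewrite [ltRHS](@probability_setT _ _ _ P).
move=> /ess_supP.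
by apply: filterS => w /=; rewrite lee_fin.
Qed.

Theorem theorem2p4 (d : measure_display) (T : measurableType d) (R : realType)
  (P : probability T R) (X : nat -> {RV P >-> R}) (M c : R)
  (X_indep : independent_RVs prime X)
  (X_sym : forall p : nat, prime p -> symmetric_RV (X p))
  (X_nonconst : forall p : nat, prime p -> nonconstant_RV (X p))
  (M_sup : supLoo X = M%:E)
  (c_omega : \forall l \near \oo,
     (omega l)%:R <= c * ln (l%:R : R) / ln (ln (l%:R : R))) :
  forall k : nat, (1 <= k)%N ->
  exists C : R, forall n : nat, (2 <= n)%N ->
  ('E_P[(fun w => partial_sum X n w ^+ (2 * k))%R] <=
    (C * n%:R ^+ k * M_seq M c n ^+ (2 * k) * ln n%:R ^+ (2 * k ^ 2))%:E)%E.
Proof.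
move=> k _; have [K K0 KP] := pow_omega_le_M_seq M c_omega.
set B := Num.max M 1 in KP; have B1 : 1 <= B by rewrite le_max lexx orbT.
have ln2 : 0 < ln (2 : R) by rewrite ln_gt0// ltr1n.
(* Chosen so that [1 + ln n <= D * ln n] for all [n >= 2], where [ln n >= ln 2]. *)
pose D : R := (ln 2)^-1 + 1.
exists (K ^+ (2 * k) * D ^+ (2 * k ^ 2)) => n n2.
have n1 : (1 <= n)%N by exact: ltnW.
pose S w := \sum_(1 <= l < n.+1) theta_trunc X B l w.
have bS : bounded_mfun (fun w => S w ^+ (2 * k)).
  apply: bounded_mfunX; apply: bounded_mfun_sum => l.
  exact: bounded_mfun_theta_trunc.
have lnn : ln 2 <= ln n%:R :> R by rewrite ler_ln ?posrE ?ltr0n// ler_nat.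
have lnn0 : 0 <= ln n%:R :> R by exact: le_trans (ltW ln2) lnn.
(* Almost surely [|X p|] is at most [M <= B] for all primes [p] at once, and there truncation
   changes nothing. *)
have -> : ('E_P[(fun w => partial_sum X n w ^+ (2 * k))%R] =
    (\int[P]_w (S w ^+ (2 * k)))%:E)%E.
  rewrite unlock /Rintegral fineK; last first.
    exact: integrable_fin_num (bounded_mfun_integrable P bS).
  apply: ae_eq_integral => //.
  - apply/measurable_EFinP; apply: measurable_funX; apply: measurable_sum => l.
    rewrite /theta; case: (squarefree l); last exact: measurable_cst.
    by apply: measurable_prod => p _; exact: measurable_funPT.
  - by apply/measurable_EFinP; case: bS.
  apply: filterS (supLoo_ae_le M_sup) => w wM _ /=.
  congr ((_ ^+ _)%:E); apply: eq_bigr => l _; rewrite /theta /theta_trunc.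
  case: ifP => // _; apply: eq_big_seq => p; rewrite mem_primes => /andP[pp _].
  by rewrite trunc_idE// (le_trans (wM p pp))// le_max lexx.
rewrite lee_fin.
have KM0 : 0 <= K * M_seq M c n by rewrite mulr_ge0// powR_ge0.
apply: le_trans (Rintegral_partial_sum_trunc B1 X_indep X_sym k KM0 _) _.
  by move=> l ln; exact: KP.
rewrite exprMn; apply: le_trans (ler_wpM2r _ (card_even_tuple R n k)) _.
  by rewrite mulr_ge0 ?exprn_ge0// powR_ge0.
set H := (\sum_(1 <= a < n.+1) _)%R.
have HD : H ^+ #|{: edge (2 * k)}| <= D ^+ (2 * k ^ 2) * ln n%:R ^+ (2 * k ^ 2).
  rewrite -exprMn; have HL : H <= 1 + ln n%:R by exact: sum_inv_le_ln.
  have H0 : 0 <= H by apply: sumr_ge0 => a _; rewrite invr_ge0.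
  have LD : 1 + ln n%:R <= D * ln n%:R.
    by rewrite mulrDl mul1r lerD2r mulrC ler_pdivlMr// mul1r.
  have L1 : 1 <= 1 + ln n%:R :> R by rewrite lerDl.
  have Ek : (#|{: edge (2 * k)}| <= 2 * k ^ 2)%N.
    by have := card_edge (2 * k); rewrite expnMn -[(2 ^ 2)%N]/(2 * 2)%N -mulnA leq_pmul2l.
  apply: (@le_trans _ _ ((1 + ln n%:R) ^+ #|{: edge (2 * k)}|)).
    by apply: lerXn2r => //; rewrite nnegrE (le_trans ler01).
  (* The exponent is raised while the base is [1 + ln n], which is at least 1. *)
  apply: (@le_trans _ _ ((1 + ln n%:R) ^+ (2 * k ^ 2))).
    exact: ler_weXn2l.
  have L0 := le_trans ler01 L1.
  by apply: lerXn2r => //; rewrite nnegrE// (le_trans L0 LD).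
set h := H ^+ _ in HD *; set L := ln _ ^+ _ in HD *; set Q := D ^+ _ in HD *.
set m := M_seq M c n ^+ _; set K' := K ^+ _; set N := n%:R ^+ k.
have -> : K' * Q * N * m * L = (N * (K' * m)) * (Q * L).
  by ring.
have -> : N * h * (K' * m) = N * (K' * m) * h by rewrite mulrAC.
by rewrite ler_wpM2l// mulr_ge0 ?mulr_ge0 ?exprn_ge0// powR_ge0.
Qed.
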